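(* In Euclidean 3-space $\mathbb{R}^3$ there is a nondegenerate polyhedron $P$ with the following properties: (1) $P$ is the image of a sphere-homeomorphic simplicial complex; (2) $P$ is rigid (i.e., not flexible); (3) there is a sequence of nondegenerate polyhedra $P_n$, $n=1,2,\dots$, such that (3a) for every $n$, $P_n$ and $P$ have the same combinatorial structure; (3b) $P_n$ is flexible for every $n$; (3c) $P_n$ tends to $P$ as $n\to\infty$.
   Context: A polyhedron is a continuous mapping from a finite 2-dimensional simplicial complex $K$ into $\mathbb{R}^3$ that is affine on each simplex of $K$ (the image is also called a polyhedron). The images of vertices, edges (1-simplices) and 2-simplices of $K$ are called vertices, edges and faces of the polyhedron. A polyhedron is nondegenerate if every face is a nondegenerate triangle (its three vertices are not collinear). Two nondegenerate polyhedra have the same combinatorial structure if they are mappings from the same simplicial complex $K$. A polyhedron is flexible if it admits a continuous deformation through polyhedra on the same complex $K$ during which every face remains congruent to itself (equivalently, all edge lengths are preserved), and which is not induced by a family of isometries of $\mathbb{R}^3$ (i.e., the spatial shape changes only through changes of dihedral angles); otherwise it is rigid. Convergence $P_n\to P$ of polyhedra on the same complex $K$ means that, for a fixed enumeration of the vertices of $K$, the coordinates of each vertex of $P_n$ converge to those of the corresponding vertex of $P$ (equivalently, the points of $\mathbb{R}^{3v}$ listing all vertex coordinates converge, $v$ being the number of vertices of $K$). *)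

(* Defs.v *)
From HB Require Import structures.
From mathcomp Require Import all_boot all_order all_algebra.
From mathcomp Require Import all_classical all_reals all_analysis.
Set Implicit Arguments. Unset Strict Implicit. Unset Printing Implicit Defensive.
Import Order.TTheory GRing.Theory Num.Theory.
Import numFieldNormedType.Exports.
Local Open Scope ring_scope.

Definition simplicial_complex2 (v : nat) (K : {set {set 'I_v}}) : Prop :=
  [/\ (forall s, s \in K -> (0 < #|s| <= 3)%N),
      (forall s t : {set 'I_v}, s \in K -> t \subset s -> (0 < #|t|)%N -> t \in K)
    & (forall i : 'I_v, [set i] \in K)].

Definition realization (R : realType) (v : nat) (K : {set {set 'I_v}})
  : set 'rV[R]_v :=
  [set x | (forall i, 0 <= x 0 i) /\ \sum_i x 0 i = 1 /\
           exists2 s, s \in K & forall i, x 0 i != 0 -> i \in s]%classic.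

Definition sphere2 (R : realType) : set 'rV[R]_3 :=
  [set y | \sum_i (y 0 i) ^+ 2 = 1]%classic.

Definition homeomorphic_sets (T U : topologicalType) (A : set T) (B : set U)
  : Prop :=
  exists (f : T -> U) (g : U -> T),
    [/\ {within A, continuous f}%classic, {within B, continuous g}%classic,
        (forall x, A x -> B (f x)) /\ (forall y, B y -> A (g y)),
        (forall x, A x -> g (f x) = x) & (forall y, B y -> f (g y) = y)].

Definition sphere_complex (R : realType) (v : nat) (K : {set {set 'I_v}}) :=
  homeomorphic_sets (@realization R v K) (@sphere2 R).

Definition dist2 (R : realType) (x y : 'rV[R]_3) : R :=
  \sum_i (x 0 i - y 0 i) ^+ 2.

Definition isometry3 (R : realType) (f : 'rV[R]_3 -> 'rV[R]_3) : Prop :=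
  forall x y, dist2 (f x) (f y) = dist2 x y.

(* A polyhedron on K is given by the positions of the vertices: row i of
   P : 'M_(v,3) is the image of vertex i (the map is affine on simplices). *)
Definition is_edge (v : nat) (K : {set {set 'I_v}}) (a b : 'I_v) : Prop :=
  a != b /\ [set a; b] \in K.

Definition nondegenerate_polyhedron (R : realType) (v : nat) (K : {set {set 'I_v}})
  (P : 'M[R]_(v, 3)) : Prop :=
  forall a b c : 'I_v, [set a; b; c] \in K -> #|[set a; b; c]| = 3%N ->
    \rank (col_mx (row b P - row a P) (row c P - row a P)) = 2%N.

Definition flexible_polyhedron (R : realType) (v : nat) (K : {set {set 'I_v}})
  (P : 'M[R]_(v, 3)) : Prop :=
  exists q : R -> 'M[R]_(v, 3),
    [/\ {within [set t : R | 0 <= t <= 1]%classic, continuous q}%classic,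
        q 0 = P,
        (forall t, 0 <= t <= 1 -> forall a b, is_edge K a b ->
           dist2 (row a (q t)) (row b (q t)) = dist2 (row a P) (row b P))
      & ~ (forall t, 0 <= t <= 1 -> exists f, isometry3 f /\
             forall i, row i (q t) = f (row i P))].

(* Main.v *)
Require Import Defs.
From HB Require Import structures.
From mathcomp Require Import all_boot all_order all_algebra.
From mathcomp Require Import zify ring lra.
From mathcomp Require Import all_classical all_reals all_analysis.
Import Order.TTheory GRing.Theory Num.Theory.
Import numFieldNormedType.Exports.
Local Open Scope ring_scope.

(* P is an octahedron whose two opposite apices both lie at the origin, so it is
   a doubly covered cone over a closed quadrilateral a b c d, with |a| = |c| = 1
   and |b| = |d| = 5. The cone behaves like a spherical four-bar linkage. For P
   it is flat and the angle between d and a is the sum of the other three, so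
   the spherical triangle inequality leaves no freedom, and the second apex is
   pinned by its distances to three non-collinear points. P_n is P folded along
   the ray of c; the angle between d and a is now smaller than the sum and the
   linkage moves, with s = <a, c> as parameter. *)

(** * Entrywise limits and continuity of matrix-valued maps *)

(** A basic neighbourhood of a matrix is a finite family of neighbourhoods of its entries, and a
    filter is closed under finite intersections. *)
Lemma cvg_mx_entries (R : realType) (T : Type) (F : set_system T)
    {FF : Filter F} (m n : nat) (f : T -> 'M[R]_(m, n)) (M : 'M[R]_(m, n)) :
  (forall i j, (f x i j @[x --> F] --> M i j)%classic) -> (f @ F --> M)%classic.
Proof.
move=> fM A [Q MQ QA]; rewrite nbhs_simpl.
have : \forall x \near F, forall i j, Q i j (f x i j).
  apply: filter_forall => i; apply: filter_forall => j.
  exact: (fM i j _ (MQ i j)).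
by apply: filterS => x xQ; apply: QA.
Qed.

Lemma continuous_mx_entries (R : realType) (T : topologicalType) (m n : nat)
    (f : T -> 'M[R]_(m, n)) (x : T) :
  (forall i j, continuous_at x (fun z => f z i j)) -> continuous_at x f.
Proof. exact: cvg_mx_entries. Qed.

Lemma continuous_scalemx (R : realType) (T : topologicalType) (m n : nat)
    (s : T -> R) (f : T -> 'M[R]_(m, n)) (x : T) :
  continuous_at x s -> continuous_at x f ->
  continuous_at x (fun z => s z *: f z).
Proof.
move=> sx fx; apply: continuous_mx_entries => i j.
under eq_fun do rewrite mxE.
apply: continuousM => //.
apply: (continuous_comp (f := f) (g := fun M : 'M[R]_(m, n) => M i j)) => //.
exact: coord_continuous.
Qed.

(** * The boundary complex of the octahedron *)

(* Vertices congruent modulo 3 are antipodal. *)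
Definition octahedron : {set {set 'I_6}} :=
  [set s : {set 'I_6} | (s != finset.set0)
    && [forall i in s, forall j in s, (i == j %[mod 3]) ==> (i == j)]].

Lemma octahedronP (s : {set 'I_6}) :
  reflect ((exists i, i \in s) /\
           {in s &, forall i j : 'I_6, i = j %[mod 3] -> i = j})
          (s \in octahedron).
Proof.
rewrite inE; apply: (iffP andP) => -[].
  move=> /set0Pn s0 /forall_inP sP; split=> // i j si sj ij.
  have /forall_inP/(_ j sj)/implyP := sP i si.
  by move=> h; apply/eqP/h/eqP.
move=> s0 sP; split; first exact/set0Pn.
apply/forall_inP => i si; apply/forall_inP => j sj; apply/implyP => /eqP ij.
exact/eqP/sP.
Qed.

Lemma octahedron_complex : simplicial_complex2 octahedron.
Proof.
split=> [s /octahedronP[[i si] sP]|s t /octahedronP[_ sP] ts|i].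
- rewrite card_gt0; apply/andP; split; first by apply/set0Pn; exists i.
  (* Reduction modulo 3 is injective on a simplex, so a simplex has at most three vertices. *)
  have <- : #|[set (inord (j %% 3) : 'I_3) | j : 'I_6 in s]| = #|s|.
    apply: card_in_imset => j k sj sk /(congr1 val) /=.
    by rewrite !inordK ?ltn_pmod//; exact: sP.
  by rewrite -[X in (_ <= X)%N](card_ord 3) max_card.
- rewrite card_gt0 => /set0Pn t0; apply/octahedronP; split=> // i j ti tj.
  by apply: sP; apply: (fintype.subsetP ts).
- by apply/octahedronP; split=> [|j k]; [exists i|]; rewrite ?inE// => /eqP-> /eqP->.
Qed.

Lemma octahedron_edge (i j : 'I_6) :
  is_edge octahedron i j <-> (i != j %[mod 3])%N.
Proof.
split=> [[ij /octahedronP[_ sP]]|ij].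
  by apply: contra ij => /eqP ij; apply/eqP/sP; rewrite // !inE eqxx ?orbT.
split; first by apply: contra ij => /eqP->.
apply/octahedronP; split=> [|k l]; first by exists i; rewrite !inE eqxx.
rewrite !inE => /orP[] /eqP-> /orP[] /eqP-> // h; move: ij.
  by rewrite h eqxx.
by rewrite -h eqxx.
Qed.

Lemma octahedron_face (i j k : 'I_6) :
  [set i; j; k] \in octahedron -> #|[set i; j; k]| = 3%N ->
  [/\ (i != j %[mod 3])%N, (j != k %[mod 3])%N & (i != k %[mod 3])%N].
Proof.
move=> /octahedronP[_ sP]; rewrite finset.setUC cardsU1 cards2 !inE.
have h (a b : 'I_6) : a \in [set i; j; k] -> b \in [set i; j; k] -> a != b ->
    (a != b %[mod 3])%N.
  by move=> sa sb; apply: contra => /eqP ab; apply/eqP/sP.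
rewrite (eq_sym k i) (eq_sym k j).
have [->|ij] := eqVneq i j; first by case: (j == k).
have [//|ik] := eqVneq i k; have [//|jk _] := eqVneq j k.
by split; apply: h; rewrite // !inE eqxx ?orbT.
Qed.

Lemma ord6P (i : 'I_6) :
  (exists k, i = @lshift 3 3 k) \/ (exists k, i = @rshift 3 3 k).
Proof.
rewrite -(@splitK 3 3 i).
by case: (fintype.split _) => k; [left|right]; exists k.
Qed.

(** * The octahedron is a topological sphere: its realization is the unit sphere of the l1 norm *)

Section CrossPolytope.
Context {R : realType}.

(** This is max(t, 0), written with the absolute value so that its identities and its continuity
    come from those of the norm. *)
Definition pos_part (t : R) : R := (`|t| + t) / 2.

Lemma pos_part_ge0 t : 0 <= pos_part t.
Proof. by rewrite divr_ge0// -lerBlDr sub0r -normrN ler_norm. Qed.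

Lemma pos_partB t : pos_part t - pos_part (- t) = t.
Proof. by rewrite /pos_part normrN; field. Qed.

Lemma pos_partD t : pos_part t + pos_part (- t) = `|t|.
Proof. by rewrite /pos_part normrN; field. Qed.

Lemma pos_part_mul t : pos_part t * pos_part (- t) = 0.
Proof.
transitivity ((`|t| ^+ 2 - t ^+ 2) / 4); first by rewrite /pos_part normrN; field.
by rewrite real_normK ?num_real// subrr mul0r.
Qed.

Lemma pos_part_scale a t : 0 <= a -> pos_part (a * t) = a * pos_part t.
Proof. by move=> a0; rewrite /pos_part normrM (ger0_norm a0); field. Qed.

Lemma pos_part_sub (a b : R) : 0 <= a -> 0 <= b -> a * b = 0 ->
  pos_part (a - b) = a.
Proof.
move=> a0 b0 /eqP; rewrite mulf_eq0 => /orP[]/eqP->; rewrite /pos_part.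
  by rewrite sub0r normrN ger0_norm// subrr mul0r.
by rewrite subr0 ger0_norm//; field.
Qed.

Definition l1norm (y : 'rV[R]_3) : R := \sum_i `|y 0 i|.
Definition l2norm (y : 'rV[R]_3) : R := Num.sqrt (\sum_i y 0 i ^+ 2).

Lemma l1norm_scale a y : 0 <= a -> l1norm (a *: y) = a * l1norm y.
Proof.
move=> a0; rewrite /l1norm mulr_sumr; apply: eq_bigr => i _.
by rewrite mxE normrM (ger0_norm a0).
Qed.

Lemma l2norm_scale a y : 0 <= a -> l2norm (a *: y) = a * l2norm y.
Proof.
move=> a0; rewrite /l2norm -[X in X * _](ger0_norm a0) -sqrtr_sqr -sqrtrM ?sqr_ge0//.
rewrite mulr_sumr; congr Num.sqrt; apply: eq_bigr => i _.
by rewrite mxE exprMn.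
Qed.

Lemma l1norm_gt0 {y : 'rV[R]_3} : y != 0 -> 0 < l1norm y.
Proof.
move=> y0; rewrite lt_def sumr_ge0 ?andbT//.
apply: contra y0 => /eqP /(psumr_eq0P (fun i _ => normr_ge0 (y 0 i))) y0.
by apply/eqP/rowP => i; rewrite mxE; apply/normr0_eq0/y0.
Qed.

Lemma l2norm_gt0 {y : 'rV[R]_3} : y != 0 -> 0 < l2norm y.
Proof.
move=> y0; rewrite sqrtr_gt0 lt_def sumr_ge0 ?andbT//; last first.
  by move=> i _; exact: sqr_ge0.
apply: contra y0 => /eqP /(psumr_eq0P (fun i _ => sqr_ge0 (y 0 i))) y0.
by apply/eqP/rowP => i; rewrite mxE; apply/eqP; rewrite -sqrf_eq0 y0.
Qed.

(** Vertex k is sent to the k-th unit vector and its antipode k + 3 to the opposite vector, with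
    affine extension. [unfold_coord] recovers barycentric coordinates as positive and negative
    parts. *)
Definition fold_coord (x : 'rV[R]_6) : 'rV[R]_3 :=
  @lsubmx _ 1 3 3 x - @rsubmx _ 1 3 3 x.

Definition unfold_coord (y : 'rV[R]_3) : 'rV[R]_6 :=
  @row_mx _ 1 3 3 (map_mx pos_part y) (map_mx pos_part (- y)).

Lemma fold_coordE x i :
  fold_coord x 0 i = x 0 (@lshift 3 3 i) - x 0 (@rshift 3 3 i).
Proof. by rewrite !mxE. Qed.

Lemma unfold_coord_l y i : unfold_coord y 0 (@lshift 3 3 i) = pos_part (y 0 i).
Proof. by rewrite [LHS]row_mxEl mxE. Qed.

Lemma unfold_coord_r y i : unfold_coord y 0 (@rshift 3 3 i) = pos_part (- y 0 i).
Proof. by rewrite [LHS]row_mxEr !mxE. Qed.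

Lemma row6P (x y : 'rV[R]_6) :
  (forall i, x 0 (@lshift 3 3 i) = y 0 (@lshift 3 3 i)) ->
  (forall i, x 0 (@rshift 3 3 i) = y 0 (@rshift 3 3 i)) -> x = y.
Proof.
move=> xyl xyr; apply/rowP => i.
by case: (ord6P i) => -[k ->].
Qed.

Lemma fold_coordZ a x : fold_coord (a *: x) = a *: fold_coord x.
Proof. by apply/rowP => i; rewrite [RHS]mxE !fold_coordE !mxE mulrBr. Qed.

Lemma unfold_coordZ a y : 0 <= a -> unfold_coord (a *: y) = a *: unfold_coord y.
Proof.
move=> a0; apply: row6P => i; rewrite [RHS]mxE.
  by rewrite !unfold_coord_l mxE pos_part_scale.
by rewrite !unfold_coord_r mxE -mulrN pos_part_scale.
Qed.

Lemma unfold_coordK y : fold_coord (unfold_coord y) = y.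
Proof.
by apply/rowP => i; rewrite fold_coordE unfold_coord_l unfold_coord_r pos_partB.
Qed.

Section Realization.
Context {x : 'rV[R]_6} (hx : realization octahedron x).

Let x_ge0 i : 0 <= x 0 i.
Proof. by have [] := hx. Qed.

Let x_antipode i : x 0 (@lshift 3 3 i) * x 0 (@rshift 3 3 i) = 0.
Proof.
have [_ [_ [s /octahedronP[_ sK] xs]]] := hx.
apply/eqP; rewrite mulf_eq0; apply: contraT; rewrite negb_or => /andP[/xs sl /xs sr].
have /(congr1 val)/= : @lshift 3 3 i = @rshift 3 3 i :> 'I_6.
  by apply: sK => //=; rewrite modnDl.
lia.
Qed.

Lemma realization_unfold : unfold_coord (fold_coord x) = x.
Proof.
apply: row6P => i; rewrite ?unfold_coord_l ?unfold_coord_r fold_coordE ?opprB.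
  exact: pos_part_sub.
by apply: pos_part_sub; rewrite // mulrC.
Qed.

(** Of two antipodal coordinates at most one is nonzero, so the absolute value of their difference
    is their sum, and barycentric coordinates sum to 1. *)
Lemma realization_l1norm : l1norm (fold_coord x) = 1.
Proof.
have [_ [<- _]] := hx; rewrite (@big_split_ord _ _ _ 3 3)/= -big_split/=.
apply: eq_bigr => i _.
rewrite -[in RHS]realization_unfold unfold_coord_l unfold_coord_r.
by rewrite pos_partD.
Qed.

Lemma realization_fold_neq0 : fold_coord x != 0.
Proof.
apply: contra_eq_neq realization_l1norm => ->.
by rewrite /l1norm big1 1?eq_sym ?oner_eq0// => i _; rewrite mxE normr0.
Qed.

End Realization.

Lemma unfold_realization (y : 'rV[R]_3) : l1norm y = 1 ->
  realization octahedron (unfold_coord y).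
Proof.
move=> y1.
have ge0 i : 0 <= unfold_coord y 0 i.
  case: (ord6P i) => -[j ->].
    by rewrite unfold_coord_l pos_part_ge0.
  by rewrite unfold_coord_r pos_part_ge0.
have sum1 : \sum_i unfold_coord y 0 i = 1.
  rewrite (@big_split_ord _ _ _ 3 3)/= -big_split/= -y1.
  by apply: eq_bigr => i _; rewrite unfold_coord_l unfold_coord_r pos_partD.
split=> //; split=> //.
(* The carrying simplex is the support: nonempty because the coordinates sum to 1, free of antipodes
   because t and -t never both have a nonzero positive part. *)
exists [set i | unfold_coord y 0 i != 0]%SET; last by move=> i; rewrite inE.
apply/octahedronP; split.
  suff /existsP[i yi] : [exists i, unfold_coord y 0 i != 0].
    by exists i; rewrite inE.
  apply: contraT; rewrite negb_exists => /forallP y0.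
  move/eqP: sum1; rewrite big1 1?eq_sym ?oner_eq0// => i _.
  by apply/eqP; rewrite -[_ == _]negbK.
have mul0 k : unfold_coord y 0 (@lshift 3 3 k) * unfold_coord y 0 (@rshift 3 3 k) = 0.
  by rewrite unfold_coord_l unfold_coord_r pos_part_mul.
have ne k : unfold_coord y 0 (@lshift 3 3 k) != 0 ->
    unfold_coord y 0 (@rshift 3 3 k) != 0 -> False.
  by move=> yl yr; move/eqP: (mul0 k); rewrite mulf_eq0 (negbTE yl) (negbTE yr).
move=> i j; rewrite !inE.
case: (ord6P i) => -[k ->]; case: (ord6P j) => -[l ->] yk yl /=.
- by rewrite !modn_small// => /val_inj ->.
- by rewrite modnDl !modn_small// => /val_inj kl; case: (ne l); rewrite // -kl.
- by rewrite modnDl !modn_small// => /val_inj kl; case: (ne l); rewrite // -kl.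
- by rewrite !modnDl !modn_small// => /val_inj ->.
Qed.

Lemma sphere_l2norm {y : 'rV[R]_3} : sphere2 y <-> l2norm y = 1.
Proof.
split=> [y1|]; first by rewrite /l2norm y1 sqrtr1.
move=> /(congr1 (fun z => z ^+ 2)); rewrite sqr_sqrtr ?expr1n//.
by apply: sumr_ge0 => i _; exact: sqr_ge0.
Qed.

Lemma sphere_neq0 {y : 'rV[R]_3} : sphere2 y -> y != 0.
Proof.
move/sphere_l2norm; apply: contra_eq_neq => ->.
by rewrite /l2norm big1 ?sqrtr0 1?eq_sym ?oner_eq0// => i _; rewrite mxE expr0n.
Qed.

Lemma pos_part_continuous : continuous pos_part.
Proof.
move=> t; apply: cvgMr_tmp; apply: cvgD; last exact: cvg_id.
exact: norm_continuous.
Qed.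

Lemma fold_coord_continuous : continuous fold_coord.
Proof.
move=> x; apply: continuous_mx_entries => i j; rewrite (ord1 i).
under eq_fun do rewrite fold_coordE.
by apply: continuousB; exact: coord_continuous.
Qed.

Lemma unfold_coord_continuous : continuous unfold_coord.
Proof.
move=> y; apply: continuous_mx_entries => i j; rewrite (ord1 i).
case: (ord6P j) => -[k ->].
  under eq_fun do rewrite unfold_coord_l.
  by apply: continuous_comp; [exact: coord_continuous|exact: pos_part_continuous].
under eq_fun do rewrite unfold_coord_r.
apply: (continuous_comp (f := fun z : 'rV_3 => - z 0 k)).
  by apply: continuousN; exact: coord_continuous.
exact: pos_part_continuous.
Qed.

Lemma l1norm_continuous : continuous (@l1norm).
Proof.
apply: continuous_big => [|i _ y]; first exact: add_continuous.
apply: (continuous_comp (f := fun z : 'rV_3 => z 0 i)).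
  exact: coord_continuous.
exact: norm_continuous.
Qed.

Lemma l2norm_continuous : continuous (@l2norm).
Proof.
move=> y; apply: (continuous_comp (g := Num.sqrt)); last exact: sqrt_continuous.
apply: continuous_big => [|i _ {}y]; first exact: add_continuous.
under eq_fun do rewrite expr2.
by apply: continuousM; exact: coord_continuous.
Qed.

(** The two maps are radial projections between the l1 and l2 unit spheres, composed with folding
    and unfolding. Since [unfold_coord] commutes with nonnegative scalings, the two normalizing
    factors cancel. *)
Lemma octahedron_sphere : @sphere_complex R 6 octahedron.
Proof.
exists (fun x => (l2norm (fold_coord x))^-1 *: fold_coord x).
exists (fun y => (l1norm y)^-1 *: unfold_coord y).
split.
- apply: continuous_in_subspaceT => x; rewrite inE => hx.
  apply: continuous_scalemx; last exact: fold_coord_continuous.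
  apply: (@continuousV R _ (fun z => l2norm (fold_coord z))); first exact/lt0r_neq0/l2norm_gt0/realization_fold_neq0.
  apply: continuous_comp; [exact: fold_coord_continuous|exact: l2norm_continuous].
- apply: continuous_in_subspaceT => y; rewrite inE => /sphere_neq0 y0.
  apply: continuous_scalemx; last exact: unfold_coord_continuous.
  by apply: (@continuousV R _ l1norm); [exact/lt0r_neq0/l1norm_gt0|exact: l1norm_continuous].
- split=> [x hx|y /sphere_neq0/l1norm_gt0 y0].
    have n0 := l2norm_gt0 (realization_fold_neq0 hx).
    by apply/sphere_l2norm; rewrite l2norm_scale ?invr_ge0 ?ltW// mulVf ?gt_eqF.
  rewrite -unfold_coordZ ?invr_ge0 ?ltW//; apply: unfold_realization.
  by rewrite l1norm_scale ?invr_ge0 ?ltW// mulVf ?gt_eqF.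
- move=> x hx; have n0 := l2norm_gt0 (realization_fold_neq0 hx).
  rewrite l1norm_scale ?invr_ge0 ?ltW// unfold_coordZ ?invr_ge0 ?ltW//.
  rewrite realization_l1norm// mulr1 invrK scalerA divff ?gt_eqF// scale1r.
  exact: realization_unfold.
- move=> y hy; have := l1norm_gt0 (sphere_neq0 hy) => n0.
  rewrite fold_coordZ unfold_coordK l2norm_scale ?invr_ge0 ?ltW//.
  move/sphere_l2norm: hy => ->.
  by rewrite mulr1 invrK scalerA divff ?gt_eqF// scale1r.
Qed.

End CrossPolytope.

(** * Coordinates, distances and rank in 3-space *)

Section Geometry.
Context {R : realType}.
Implicit Types (u s w : R) (x y : 'rV[R]_3).

Let i0 : 'I_3 := @Ordinal 3 0 isT.
Let i1 : 'I_3 := @Ordinal 3 1 isT.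
Let i2 : 'I_3 := @Ordinal 3 2 isT.

Lemma ord3_ind (Q : 'I_3 -> Prop) : Q i0 -> Q i1 -> Q i2 -> forall i, Q i.
Proof.
move=> Q0 Q1 Q2 [[|[|[|//]]] ?].
- by rewrite (_ : Ordinal _ = i0)//; apply/val_inj.
- by rewrite (_ : Ordinal _ = i1)//; apply/val_inj.
- by rewrite (_ : Ordinal _ = i2)//; apply/val_inj.
Qed.

Lemma row3P x y : x 0 i0 = y 0 i0 -> x 0 i1 = y 0 i1 -> x 0 i2 = y 0 i2 -> x = y.
Proof. by move=> *; apply/rowP; apply: ord3_ind. Qed.

Lemma sum3 (f : 'I_3 -> R) : \sum_i f i = f i0 + f i1 + f i2.
Proof.
rewrite !big_ord_recr big_ord0/= add0r.
by congr (f _ + f _ + f _); apply/val_inj.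
Qed.

Lemma dist2E x y : dist2 x y = (x 0 i0 - y 0 i0) ^+ 2 +
  (x 0 i1 - y 0 i1) ^+ 2 + (x 0 i2 - y 0 i2) ^+ 2.
Proof. exact: sum3. Qed.

Lemma dist2C x y : dist2 x y = dist2 y x.
Proof. by rewrite !dist2E; ring. Qed.

Definition vec3 (a b c : R) : 'rV[R]_3 := \row_j nth 0 [:: a; b; c] j.

Lemma dist2_vec3 a b c a' b' c' : dist2 (vec3 a b c) (vec3 a' b' c') =
  (a - a') ^+ 2 + (b - b') ^+ 2 + (c - c') ^+ 2.
Proof. by rewrite dist2E !mxE. Qed.

Lemma vec3_0 : vec3 0 0 0 = 0.
Proof. by apply: row3P; rewrite !mxE. Qed.

(** A nonzero minor on the first two columns suffices: eliminating either coefficient from a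
    vanishing combination multiplies the other one by this minor. *)
Lemma rank_col_mx2 x y :
  x 0 i0 * y 0 i1 - x 0 i1 * y 0 i0 != 0 -> \rank (col_mx x y) = 2%N.
Proof.
move=> xy0; apply/eqP; rewrite -[_ == _]/(row_free (col_mx x y)).
apply: inj_row_free => v; rewrite -[v]hsubmxK mul_row_col.
rewrite [lsubmx v]mx11_scalar [rsubmx v]mx11_scalar !mul_scalar_mx.
move: (_ 0 0) (_ 0 0) => b a /rowP ab.
have := ab i0; have := ab i1; rewrite !mxE => ab1 ab0.
have /eqP : a * (x 0 i0 * y 0 i1 - x 0 i1 * y 0 i0) = 0.
  transitivity ((a * x 0 i0 + b * y 0 i0) * y 0 i1 -
    (a * x 0 i1 + b * y 0 i1) * y 0 i0); first by ring.
  by rewrite ab0 ab1; ring.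
have /eqP : b * (x 0 i0 * y 0 i1 - x 0 i1 * y 0 i0) = 0.
  transitivity ((a * x 0 i1 + b * y 0 i1) * x 0 i0 -
    (a * x 0 i0 + b * y 0 i0) * x 0 i1); first by ring.
  by rewrite ab0 ab1; ring.
rewrite !mulf_eq0 (negbTE xy0) !orbF => /eqP-> /eqP->.
by rewrite !raddf0 row_mx0.
Qed.

(** * The family of octahedra with coinciding apices *)

(** In this order the pairs [n], [s] and [a], [c] and [b], [d] are antipodal modulo 3, so [a b c d]
    is the equator and [n], [s] are the apices. *)
Definition octahedron_mx (n a b s c d : 'rV[R]_3) : 'M[R]_(6, 3) :=
  \matrix_i nth 0 [:: n; a; b; s; c; d] i.

(* arm u s is the vector of length 5 having scalar products u and 4 with the
   unit vectors (1, 0, 0) and (s, sqrt (1 - s^2), 0). *)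
Definition arm_y u s : R := (4 - u * s) / Num.sqrt (1 - s ^+ 2).

Definition arm u s :=
  vec3 u (arm_y u s) (Num.sqrt (25 - u ^+ 2 - arm_y u s ^+ 2)).

Definition config u s := octahedron_mx 0 (vec3 1 0 0) (arm 3 s)
  0 (vec3 s (Num.sqrt (1 - s ^+ 2)) 0) (arm u s).

(* (1 - s^2) times the radicand of the last coordinate of arm u s equals
   9 - u^2 + 8 u s - 25 s^2. *)
Definition reachable u s := (s ^+ 2 < 1) && (25 * s ^+ 2 <= 9 - u ^+ 2 + 8 * u * s).

Lemma arm_dist u s : reachable u s ->
  [/\ dist2 (arm u s) 0 = 25, dist2 (arm u s) (vec3 1 0 0) = 26 - 2 * u &
      dist2 (arm u s) (vec3 s (Num.sqrt (1 - s ^+ 2)) 0) = 18].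
Proof.
move=> /andP[s1 us]; set w := Num.sqrt _.
have w0 : 0 < w by rewrite sqrtr_gt0; lra.
have w2 : w ^+ 2 = 1 - s ^+ 2 by rewrite sqr_sqrtr//; lra.
have yw : arm_y u s * w = 4 - u * s by rewrite divfK ?gt_eqF.
have z2 : Num.sqrt (25 - u ^+ 2 - arm_y u s ^+ 2) ^+ 2 =
    25 - u ^+ 2 - arm_y u s ^+ 2.
  rewrite sqr_sqrtr//.
  (* Multiplying the radicand by w^2 = 1 - s^2 clears the denominator and leaves the inequality in
     [reachable]. *)
  rewrite -(pmulr_rge0 _ (exprn_gt0 2 w0)) mulrBr -exprMn [w * _]mulrC yw w2.
  nra.
rewrite -vec3_0 /arm !dist2_vec3; split.
- by rewrite !subr0 z2; ring.
- by rewrite !subr0 z2; ring.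
- rewrite !subr0 z2.
  transitivity (25 - 2 * (u * s + arm_y u s * w) + (s ^+ 2 + w ^+ 2)); first by ring.
  by rewrite yw w2; ring.
Qed.

(** By [arm_dist] every edge length is a constant or depends on [u] alone. The only distances that
    may vary with [s] join antipodal vertices, which span no edge. *)
Lemma config_edges u s s' : reachable 3 s -> reachable u s ->
  reachable 3 s' -> reachable u s' ->
  forall i j, is_edge octahedron i j ->
  dist2 (row i (config u s)) (row j (config u s)) =
  dist2 (row i (config u s')) (row j (config u s')).
Proof.
move=> /[dup] bs /andP[s1 _] ds /[dup] bs' /andP[s1' _] ds' i j /octahedron_edge.
have [b1 b2 b3] := arm_dist _ _ bs; have [b1' b2' b3'] := arm_dist _ _ bs'.
have [d1 d2 d3] := arm_dist _ _ ds; have [d1' d2' d3'] := arm_dist _ _ ds'.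
have c1 t : t ^+ 2 < 1 -> dist2 (vec3 t (Num.sqrt (1 - t ^+ 2)) 0) 0 = 1.
  by move=> t1; rewrite -vec3_0 dist2_vec3 !subr0 sqr_sqrtr; [ring|lra].
have c2 := c1 _ s1; have c3 := c1 _ s1'.
rewrite !rowK.
have E := (dist2C 0, dist2C (vec3 _ _ _) (arm _ _), b1, b2, b3, b1', b2', b3',
  d1, d2, d3, d1', d2', d3', c2, c3).
by case: i j => [[|[|[|[|[|[|//]]]]]] ?] [[|[|[|[|[|[|//]]]]]] ?] //= _; rewrite !E.
Qed.

Lemma config0 u : config u 0 = octahedron_mx 0 (vec3 1 0 0) (vec3 3 4 0)
  0 (vec3 0 1 0) (vec3 u 4 (Num.sqrt (9 - u ^+ 2))).
Proof.
rewrite /config /arm /arm_y expr0n/= subr0 sqrtr1 !mulr0 !subr0 !divr1.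
congr octahedron_mx; congr vec3; last by congr Num.sqrt; ring.
by rewrite (_ : _ - _ = 0) ?sqrtr0//; ring.
Qed.

(** Projected to the first two coordinates, the faces over the sides ab, bc, cd, da have doubled
    areas 4, 3, -u, 4. *)
Lemma config0_nondegenerate u : u < 0 ->
  nondegenerate_polyhedron octahedron (config u 0).
Proof.
move=> u0 i j k ijk ijk3; apply: rank_col_mx2.
have [] := octahedron_face _ _ _ ijk ijk3 => {ijk ijk3}.
rewrite config0 !mxE.
case: i j k => [[|[|[|[|[|[|//]]]]]] ?] [[|[|[|[|[|[|//]]]]]] ?] [[|[|[|[|[|[|//]]]]]] ?] //= _ _ _;
  rewrite !mxE /=; apply/eqP => h; lra.
Qed.

(** * Continuous dependence of the configuration on its parameters *)

Section Convergence.
Context {T : Type} {F : set_system T} {FF : Filter F}.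
Local Open Scope classical_set_scope.

Lemma cvg_vec3 (a b c : T -> R) (a0 b0 c0 : R) :
  a @ F --> a0 -> b @ F --> b0 -> c @ F --> c0 ->
  vec3 (a t) (b t) (c t) @[t --> F] --> vec3 a0 b0 c0.
Proof.
move=> fa fb fc; apply: cvg_mx_entries => i j; under eq_fun do rewrite mxE.
by rewrite mxE; case: j => [[|[|[|//]]] ?].
Qed.

Lemma cvg_octahedron_mx (n a b s c d : T -> 'rV[R]_3)
    (n0 a0 b0 s0 c0 d0 : 'rV[R]_3) :
  n @ F --> n0 -> a @ F --> a0 -> b @ F --> b0 ->
  s @ F --> s0 -> c @ F --> c0 -> d @ F --> d0 ->
  octahedron_mx (n t) (a t) (b t) (s t) (c t) (d t) @[t --> F] -->
    octahedron_mx n0 a0 b0 s0 c0 d0.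
Proof.
have coord (f : T -> 'rV[R]_3) (f0 : 'rV[R]_3) j : f @ F --> f0 ->
    f t 0 j @[t --> F] --> f0 0 j.
  move=> ff0; apply: (cvg_comp f (fun M : 'rV[R]_3 => M 0 j) ff0).
  exact: coord_continuous.
move=> *; apply: cvg_mx_entries => i j; under eq_fun do rewrite mxE.
by rewrite mxE; case: i => [[|[|[|[|[|[|//]]]]]] ?] /=; exact: coord.
Qed.

(** Square roots are continuous even where the radicand vanishes, as in the flat case, and the only
    denominator has the nonzero limit sqrt (1 - s0^2). This serves both the motion in [s] and the
    convergence in [u]. *)
Lemma cvg_config (u s : T -> R) (u0 s0 : R) : s0 ^+ 2 < 1 ->
  u @ F --> u0 -> s @ F --> s0 -> config (u t) (s t) @[t --> F] --> config u0 s0.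
Proof.
move=> s1 fu fs.
have sqr_cvg (f : T -> R) (f0 : R) : f @ F --> f0 -> f t ^+ 2 @[t --> F] --> f0 ^+ 2.
  by move=> ff0; under eq_fun do rewrite expr2; rewrite expr2; exact: cvgM.
have sqrt_cvg (f : T -> R) (f0 : R) : f @ F --> f0 ->
    Num.sqrt (f t) @[t --> F] --> Num.sqrt f0.
  by move=> ff0; apply: (cvg_comp f Num.sqrt ff0); exact: sqrt_continuous.
have fw : Num.sqrt (1 - s t ^+ 2) @[t --> F] --> Num.sqrt (1 - s0 ^+ 2).
  by apply: sqrt_cvg; apply: cvgB; [exact: cvg_cst|exact: sqr_cvg].
have arm_cvg (v : T -> R) (v0 : R) : v @ F --> v0 ->
    arm (v t) (s t) @[t --> F] --> arm v0 s0.
  move=> fv.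
  have fy : arm_y (v t) (s t) @[t --> F] --> arm_y v0 s0.
    apply: cvgM; first by apply: cvgB; [exact: cvg_cst|exact: cvgM].
    by apply: cvgV => //; rewrite gt_eqF// sqrtr_gt0 subr_gt0.
  apply: cvg_vec3 => //; apply: sqrt_cvg; apply: cvgB; last exact: sqr_cvg.
  by apply: cvgB; [exact: cvg_cst|exact: sqr_cvg].
apply: cvg_octahedron_mx; [exact: cvg_cst|exact: cvg_cst| |exact: cvg_cst| |].
- by apply: arm_cvg; exact: cvg_cst.
- by apply: cvg_vec3 => //; exact: cvg_cst.
- exact: arm_cvg.
Qed.

End Convergence.

(** * Flexibility of the folded octahedra *)

Lemma config0_flexible u : -3 < u <= -2 ->
  flexible_polyhedron octahedron (config u 0).
Proof.
(* For 0 <= s <= e <= 1/10 one has 25 s^2 - 8 u s <= 26.5 s <= 50 e = 9 - u^2, so [d] is reachable;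
   [b] needs only 25 s^2 <= 24 s. *)
move=> /andP[u3 u2]; pose e := (9 - u ^+ 2) / 50.
have e0 : 0 < e by rewrite divr_gt0//; nra.
have e1 : e <= 1 / 10 by rewrite /e; nra.
have reach t : 0 <= t <= 1 -> reachable 3 (e * t) /\ reachable u (e * t).
  move=> /andP[t0 t1].
  have et0 : 0 <= e * t by rewrite mulr_ge0// ltW.
  have et1 : e * t <= e by rewrite ler_piMr// ltW.
  have eu : 9 - u ^+ 2 = 50 * e by rewrite /e; field.
  move: (e * t) et0 et1 => s s0 s1; split; apply/andP; split; nra.
exists (fun t => config u (e * t)); split.
- apply: continuous_in_subspaceT => t; rewrite inE => /reach[/andP[et1 _] _].
  apply: cvg_config => //; first exact: cvg_cst.
  by apply: cvgMl_tmp; exact: cvg_id.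
- by rewrite mulr0.
- move=> t t01 i j ij.
  have [b0 d0] := reach 0 ltac:(by rewrite lexx ler01); rewrite mulr0 in b0 d0.
  by have [bt dt] := reach t t01; exact: config_edges.
(* The squared distance between the antipodal vertices a and c is 2 - 2 s; it drops from 2 to 2 - 2
   e, which no isometry allows. *)
- move=> /(_ 1); rewrite ler01 lexx mulr1 => /(_ isT)[f [fP fE]].
  have := fP (row (@Ordinal 6 1 isT) (config u 0)) (row (@Ordinal 6 4 isT) (config u 0)).
  rewrite -!fE !rowK/= !dist2_vec3 !subr0 !sub0r !sqrrN !sqr_sqrtr; nra.
Qed.

(** * Rigidity of the flat octahedron *)

Let dot x y := x 0 i0 * y 0 i0 + x 0 i1 * y 0 i1 + x 0 i2 * y 0 i2.

(** The cross product, completing an orthonormal pair to a frame. *)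
Let normal x y := vec3 (x 0 i1 * y 0 i2 - x 0 i2 * y 0 i1)
  (x 0 i2 * y 0 i0 - x 0 i0 * y 0 i2) (x 0 i0 * y 0 i1 - x 0 i1 * y 0 i0).

Lemma orthonormal_isometry (n a c : 'rV[R]_3) :
  dot a a = 1 -> dot c c = 1 -> dot a c = 0 ->
  isometry3 (fun x => n + x 0 i0 *: a + x 0 i1 *: c + x 0 i2 *: normal a c).
Proof.
move=> aa cc ac x y.
have nn : dot (normal a c) (normal a c) = 1.
  (* Lagrange's identity for the cross product. *)
  transitivity (dot a a * dot c c - dot a c ^+ 2).
    by rewrite /dot !mxE/=; ring.
  by rewrite aa cc ac; ring.
rewrite !dist2E.
transitivity ((x 0 i0 - y 0 i0) ^+ 2 * dot a a + (x 0 i1 - y 0 i1) ^+ 2 * dot c c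
  + (x 0 i2 - y 0 i2) ^+ 2 * dot (normal a c) (normal a c)
  + 2 * (x 0 i0 - y 0 i0) * (x 0 i1 - y 0 i1) * dot a c).
  by rewrite /dot !mxE/=; ring.
by rewrite nn aa cc ac; ring.
Qed.

Lemma dist2_ge0 x y : 0 <= dist2 x y.
Proof. by apply: sumr_ge0 => i _; exact: sqr_ge0. Qed.

Lemma dist2_eq0 x y : dist2 x y = 0 -> x = y.
Proof.
move=> /(psumr_eq0P (fun i _ => sqr_ge0 (x 0 i - y 0 i))) xy.
by apply/rowP => i; apply/eqP; rewrite -subr_eq0 -sqrf_eq0 xy.
Qed.

(* Writing A = a - n and so on, the edge lengths give
   |B - 3A - 4C|^2 = 24 A.C and |D + 3A - 4C|^2 = - 24 A.C. *)
Lemma flat_pyramid_rigid (n a b c d : 'rV[R]_3) :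
  dist2 n a = 1 -> dist2 n b = 25 -> dist2 n c = 1 -> dist2 n d = 25 ->
  dist2 a b = 20 -> dist2 b c = 18 -> dist2 c d = 18 -> dist2 d a = 32 ->
  [/\ dot (a - n) (a - n) = 1, dot (c - n) (c - n) = 1, dot (a - n) (c - n) = 0,
      b = n + 3 *: (a - n) + 4 *: (c - n) & d = n + (- 3) *: (a - n) + 4 *: (c - n)].
Proof.
move=> na nb nc nd ab bc cd da.
have hb : dist2 b (n + 3 *: (a - n) + 4 *: (c - n)) = 24 * dot (a - n) (c - n).
  by move: na nb nc ab bc; rewrite !dist2E /dot !mxE; lra.
have hd : dist2 d (n + (- 3) *: (a - n) + 4 *: (c - n)) = - 24 * dot (a - n) (c - n).
  by move: na nd nc da cd; rewrite !dist2E /dot !mxE; lra.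
(* The two squared distances are nonnegative but are opposite multiples of A.C, so all three
   vanish. *)
have ac : dot (a - n) (c - n) = 0.
  by have := dist2_ge0 b (n + 3 *: (a - n) + 4 *: (c - n));
     have := dist2_ge0 d (n + (- 3) *: (a - n) + 4 *: (c - n)); rewrite hb hd; lra.
split=> //.
- by move: na; rewrite dist2E /dot !mxE; lra.
- by move: nc; rewrite dist2E /dot !mxE; lra.
- by apply: dist2_eq0; rewrite hb ac mulr0.
- by apply: dist2_eq0; rewrite hd ac mulr0.
Qed.

(* With T = s - n, equal distances from n and s to a, b = 3a + 4c and c read
   |T|^2 = 2 T.A = 2 T.C = 2 T.(3A + 4C), hence |T|^2 = 7 |T|^2. *)
Lemma apex_unique (n a c s : 'rV[R]_3) :
  dist2 s a = dist2 n a -> dist2 s c = dist2 n c ->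
  dist2 s (n + 3 *: (a - n) + 4 *: (c - n)) =
    dist2 n (n + 3 *: (a - n) + 4 *: (c - n)) -> s = n.
Proof.
move=> sa sc sb; apply: dist2_eq0.
by move: sa sc sb; rewrite !dist2E !mxE; lra.
Qed.

(** The edge lengths determine the flat configuration up to isometry, globally and not merely along
    a motion; hence every deformation preserving them is induced by isometries. *)
Lemma config_flat_congruent (Q : 'M[R]_(6, 3)) :
  (forall i j, is_edge octahedron i j ->
    dist2 (row i Q) (row j Q) = dist2 (row i (config (- 3) 0)) (row j (config (- 3) 0))) ->
  exists f, isometry3 f /\ forall i, row i Q = f (row i (config (- 3) 0)).
Proof.
rewrite config0 (_ : 9 - _ = 0 :> R) ?sqrtr0; last by ring.
move=> QP.
pose v k (k6 : (k < 6)%N) : 'I_6 := Ordinal k6.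
have QPv k l (k6 : (k < 6)%N) (l6 : (l < 6)%N) : (k != l %[mod 3])%N -> _ :=
  fun kl => QP (v k k6) (v l l6) ((octahedron_edge (v k k6) (v l l6)).2 kl).
have na := QPv 0%N 1%N isT isT isT; have nb := QPv 0%N 2%N isT isT isT.
have nc := QPv 0%N 4%N isT isT isT; have nd := QPv 0%N 5%N isT isT isT.
have ab := QPv 1%N 2%N isT isT isT; have bc := QPv 2%N 4%N isT isT isT.
have cd := QPv 4%N 5%N isT isT isT; have da := QPv 5%N 1%N isT isT isT.
have sa := QPv 3%N 1%N isT isT isT; have sb := QPv 3%N 2%N isT isT isT.
have sc := QPv 3%N 4%N isT isT isT.
move: na nb nc nd ab bc cd da sa sb sc; rewrite !rowK/= -vec3_0 !dist2_vec3.
move=> na nb nc nd ab bc cd da sa sb sc.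
have [|||||||| aa cc ac bE dE] := flat_pyramid_rigid (row (v 0%N isT) Q)
  (row (v 1%N isT) Q) (row (v 2%N isT) Q) (row (v 4%N isT) Q) (row (v 5%N isT) Q).
1-8: by rewrite ?na ?nb ?nc ?nd ?ab ?bc ?cd ?da; ring.
have sn : row (v 3%N isT) Q = row (v 0%N isT) Q.
  by apply: (apex_unique _ (row (v 1%N isT) Q) (row (v 4%N isT) Q));
     rewrite -?bE ?sa ?sb ?sc ?na ?nb ?nc.
(* The isometry takes the origin and the first two unit vectors, which are n, a and c of the flat
   model, to their counterparts in [Q]; [bE], [dE] and [sn] settle the other vertices. *)
eexists; split; first exact: (orthonormal_isometry (row (v 0%N isT) Q) _ _ aa cc ac).
case=> [[|[|[|[|[|[|//]]]]]] k6]; rewrite (eq_irrelevance k6 isT) [in RHS]rowK/=.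
- by apply: row3P; rewrite !mxE/=; ring.
- by apply: row3P; rewrite !mxE/=; ring.
- by rewrite [LHS]bE; apply: row3P; rewrite !mxE/=; ring.
- by rewrite [LHS]sn; apply: row3P; rewrite !mxE/=; ring.
- by apply: row3P; rewrite !mxE/=; ring.
- by rewrite [LHS]dE; apply: row3P; rewrite !mxE/=; ring.
Qed.

End Geometry.

Local Open Scope classical_set_scope.
Local Open Scope ring_scope.

Theorem theorem1 (R : realType) :
  exists (v : nat) (K : {set {set 'I_v}}) (P : 'M[R]_(v, 3)),
    [/\ simplicial_complex2 K, @sphere_complex R v K,
        nondegenerate_polyhedron K P, ~ flexible_polyhedron K P &
        exists Pn : nat -> 'M[R]_(v, 3),
          [/\ (forall n, nondegenerate_polyhedron K (Pn n)),
              (forall n, flexible_polyhedron K (Pn n)) &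
              Pn @ \oo --> P]].
Proof.
(* [harmonic n] is 1 / (n + 1), so these values of [u] stay in the range of [config0_flexible] and
   tend to the flat value -3. *)
have u_bounds n : -3 < (-3 + harmonic n : R) <= -2.
  have h0 := @harmonic_gt0 R n; have h1 : harmonic n <= 1 :> R.
    by rewrite invf_le1 ?ler1n ?ltr0n.
  by lra.
exists 6%N, octahedron, (config (- 3) 0); split.
- exact: octahedron_complex.
- exact: octahedron_sphere.
- by apply: config0_nondegenerate; lra.
- by move=> [q [_ _ qP]]; apply=> t t01; exact/config_flat_congruent/qP.
exists (fun n => config (- 3 + harmonic n) 0); split => [n|n|].
- by have := u_bounds n => ?; apply: config0_nondegenerate; lra.
- exact: config0_flexible.
apply: cvg_config; [by rewrite expr0n ltr01| |exact: cvg_cst].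
rewrite -[X in _ --> X]addr0; apply: cvgD; [exact: cvg_cst|exact: cvg_harmonic].
Qed.
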